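(* Let $\mathcal{A}$ be a unital $C^*$-algebra admitting a faithful tracial state $\tau$, let $\mathcal{A}_1$ be its closed unit ball, and let $x\in\mathcal{A}_1$. The following are equivalent: (i) $x$ is unitary; (ii) $x$ is a $C^*$-extreme point of $\mathcal{A}_1$; (iii) $x$ is a linear extreme point of $\mathcal{A}_1$.
   Context: For a unital $C^*$-algebra $\mathcal{B}$ with identity $\mathbf{1}_{\mathcal{B}}$, let $\mathcal{B}_1$ be its closed unit ball. An element $x\in\mathcal{B}_1$ is a $C^*$-extreme point of $\mathcal{B}_1$ if whenever $x=\sum_{i=1}^k t_i^*x_it_i$ with $x_1,\dots,x_k\in\mathcal{B}_1$ and invertible $t_1,\dots,t_k\in\mathcal{B}$ satisfying $\sum_{i=1}^k t_i^*t_i=\mathbf{1}_{\mathcal{B}}$, there exist unitaries $u_1,\dots,u_k\in\mathcal{B}$ with $x_i=u_i^*xu_i$ for $i=1,\dots,k$. A linear extreme point of $\mathcal{B}_1$ is an extreme point of the convex set $\mathcal{B}_1$ in the usual sense. A tracial state is a state $\tau$ with $\tau(ab)=\tau(ba)$ for all $a,b$; it is faithful if $\tau(a^*a)=0$ implies $a=0$. *)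

(* Defs.v *)
From HB Require Import structures.
From mathcomp Require Import all_boot all_order all_algebra.
From mathcomp Require Import complex.
From mathcomp Require Import all_classical all_reals all_analysis.

Set Implicit Arguments.
Unset Strict Implicit.
Unset Printing Implicit Defensive.

Import Order.TTheory GRing.Theory Num.Theory.
Import numFieldNormedType.Exports.

Local Open Scope classical_set_scope.
Local Open Scope ring_scope.
Local Open Scope complex_scope.

(* The norm of a normed module over R[i] takes its values in R[i] and is real
   and nonnegative for the order of R[i], in which u <= v means that v - u is
   real and nonnegative.
   The product is a field of the mixin, and the ring structure is derived from
   it below, because Hierarchy Builder does not accept a structure that
   inherits from both normed modules and rings outside of Num.NumDomain.
   The condition 1 != 0 excludes only the zero algebra, which has no state. *)
HB.mixin Record isUnitalCStar (R : realType) (A : Type)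
    of CompleteNormedModule R[i] A := {
  cstar_one : A;
  cstar_mul : A -> A -> A;
  star : A -> A;
  cstar_mulA : associative cstar_mul;
  cstar_mul1r : left_id cstar_one cstar_mul;
  cstar_mulr1 : right_id cstar_one cstar_mul;
  cstar_mulrDl : left_distributive cstar_mul +%R;
  cstar_mulrDr : right_distributive cstar_mul +%R;
  cstar_oner_neq0 : cstar_one != 0;
  cstar_scalerAl : forall (c : R[i]) (a b : A),
    c *: cstar_mul a b = cstar_mul (c *: a) b;
  cstar_scalerAr : forall (c : R[i]) (a b : A),
    c *: cstar_mul a b = cstar_mul a (c *: b);
  ler_cstar_normM : forall a b : A, `|cstar_mul a b| <= `|a| * `|b|;
  starK : involutive star;
  starD : {morph star : a b / a + b};
  starZ : forall (c : R[i]) (a : A), star (c *: a) = c^* *: star a;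
  cstar_starM : forall a b : A,
    star (cstar_mul a b) = cstar_mul (star b) (star a);
  cstar_identity : forall a : A, `|cstar_mul (star a) a| = `|a| ^+ 2
}.

#[short(type="cstarAlgType")]
HB.structure Definition UnitalCStarAlgebra (R : realType) :=
  {A of CompleteNormedModule R[i] A & isUnitalCStar R A}.

Section CStarRing.
Variables (R : realType) (A : cstarAlgType R).

HB.instance Definition _ := GRing.Zmodule_isNzRing.Build
  (UnitalCStarAlgebra.sort A) cstar_mulA cstar_mul1r cstar_mulr1
  cstar_mulrDl cstar_mulrDr cstar_oner_neq0.
HB.instance Definition _ := GRing.Lmodule_isLalgebra.Build R[i]
  (UnitalCStarAlgebra.sort A) cstar_scalerAl.
HB.instance Definition _ := GRing.Lalgebra_isAlgebra.Build R[i]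
  (UnitalCStarAlgebra.sort A) cstar_scalerAr.

Lemma starM (a b : A) : star (a * b) = star b * star a.
Proof. exact: cstar_starM. Qed.

Lemma ler_normM_cstar (a b : A) : `|a * b| <= `|a| * `|b|.
Proof. exact: ler_cstar_normM. Qed.

Lemma normr_starM (a : A) : `|star a * a| = `|a| ^+ 2.
Proof. exact: cstar_identity. Qed.

End CStarRing.

Section CStarDefs.
Context {R : realType} {A : cstarAlgType R}.
Implicit Types (a b x u t : A) (tau : {scalar A}).

Definition cstar_ball : set A := [set a | `|a| <= 1].

Definition cstar_invertible t := exists s, s * t = 1 /\ t * s = 1.

Definition cstar_unitary u := star u * u = 1 /\ u * star u = 1.

(* 0 <= z in R[i] entails that z is real. *)
Definition is_state tau := (forall a, 0 <= tau (star a * a)) /\ tau 1 = 1.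

Definition is_tracial_state tau :=
  is_state tau /\ forall a b, tau (a * b) = tau (b * a).

Definition is_faithful tau := forall a, tau (star a * a) = 0 -> a = 0.

Definition cstar_extreme_point x :=
  cstar_ball x /\
  forall (k : nat) (y t : 'I_k -> A),
    (forall i, cstar_ball (y i)) ->
    (forall i, cstar_invertible (t i)) ->
    \sum_(i < k) star (t i) * t i = 1 ->
    x = \sum_(i < k) star (t i) * y i * t i ->
    exists u : 'I_k -> A,
      forall i, cstar_unitary (u i) /\ y i = star (u i) * x * u i.

End CStarDefs.

Definition linear_extreme_point (R : realType) (V : lmodType R[i])
    (E : set V) (x : V) :=
  E x /\
  forall (y z : V) (s : R), E y -> E z -> 0 < s < 1 ->
    x = s%:C *: y + (1 - s)%:C *: z -> y = x /\ z = x.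

(* Main.v *)
(* The trace form [T := Re tau] is positive, faithful and symmetric, and these
   properties replace functional calculus and GNS arguments.
   Square roots [sqrt (1 - z)], for [z] self-adjoint in the unit ball, come from
   the iteration [r <- (z + r ^ 2) / 2], which is dominated by its scalar
   version at [z = 1]; with the trace they give [|t|] for every [t].
   If [x] is unitary and [x = sum t_i^* y_i t_i], equality holds in
   Cauchy-Schwarz, so [y_i t_i = t_i x]. This says [y_i = x] when the [t_i] are
   scalars, and in general [x] commutes with [|t_i|] and [y_i = u x u^*] for the
   unitary [u := t_i |t_i|^-1].
   Conversely let [x] be extreme in either sense. If [x + b] and [x - b] are in
   the ball, both are equal to [x] or unitarily equivalent to [x], so the
   parallelogram identity for [T] gives [b = 0]. Multiples [b] of
   [x (1 - x^* x)] show that [x] is a partial isometry, and elements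
   [b] of [q A p], where [p := 1 - x^* x] and [q := 1 - x x^*], show that
   [q A p = 0]. Then [T (x^*^n x^n) = 1 - n T p] for all [n], whence
   [T p = 0] and [p = 0]; finally [T q = T p = 0]. *)
Require Import Defs.
From HB Require Import structures.
From mathcomp Require Import all_boot all_order all_algebra.
From mathcomp Require Import complex.
From mathcomp Require Import all_classical all_reals all_analysis.
From mathcomp Require Import ring lra.
Set Implicit Arguments.
Unset Strict Implicit.
Import Order.TTheory GRing.Theory Num.Theory.
Import numFieldNormedType.Exports.
Local Open Scope ring_scope.
Local Open Scope complex_scope.

(** * The norm as a real number, and the involution *)

Section RealNorm.
Context {R : realType} {A : cstarAlgType R}.
Implicit Types (a b c : A) (r : R).

Definition nm a : R := complex.Re `|a|.

Lemma nmE a : `|a| = (nm a)%:C.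
Proof. by rewrite /nm RRe_real // ger0_real. Qed.

Lemma nm_ge0 a : 0 <= nm a.
Proof. by rewrite -ler0c -nmE. Qed.

Lemma cstar_ballE a : cstar_ball a = (nm a <= 1) :> Prop.
Proof. by rewrite /cstar_ball /= nmE (lecR _ 1). Qed.

Lemma nmD a b : nm (a + b) <= nm a + nm b.
Proof. by rewrite -lecR rmorphD /= -!nmE ler_normD. Qed.

Lemma nmN a : nm (- a) = nm a.
Proof. by rewrite /nm normrN. Qed.

Lemma nmB a b : nm (a - b) <= nm a + nm b.
Proof. by rewrite (le_trans (nmD _ _)) // nmN. Qed.

Lemma nmBC a b : nm (a - b) = nm (b - a).
Proof. by rewrite -nmN opprB. Qed.

Lemma nmM a b : nm (a * b) <= nm a * nm b.
Proof. by rewrite -lecR rmorphM /= -!nmE ler_normM_cstar. Qed.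

Lemma nmZ r a : nm (r%:C *: a) = `|r| * nm a.
Proof.
apply: complexI; rewrite rmorphM /= -!nmE normrZ normc_def /=.
by rewrite expr0n addr0 sqrtr_sqr.
Qed.

Lemma nm0 : nm (0 : A) = 0.
Proof. by rewrite /nm normr0. Qed.

Lemma nm_eq0 a : nm a = 0 -> a = 0.
Proof. by move=> a0; apply/normr0_eq0; rewrite nmE a0. Qed.

Lemma nm_starM a : nm (star a * a) = nm a ^+ 2.
Proof. by apply: complexI; rewrite rmorphXn /= -!nmE normr_starM. Qed.

Lemma nm_star a : nm (star a) = nm a.
Proof.
suff le_star b : nm b <= nm (star b).
  by apply/eqP; rewrite eq_le le_star andbT -{2}[a]starK le_star.
have := nmM (star b) b; rewrite nm_starM expr2.
have := nm_ge0 b; rewrite le_eqVlt => /orP[/eqP <- _|b0]; first exact: nm_ge0.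
by rewrite ler_pM2r.
Qed.

Lemma star0 : star (0 : A) = 0.
Proof. by apply: (@addrI _ (star 0)); rewrite -starD !addr0. Qed.

Lemma starN a : star (- a) = - star a.
Proof. by apply/eqP; rewrite -addr_eq0 -starD addNr star0. Qed.

Lemma starB a b : star (a - b) = star a - star b.
Proof. by rewrite starD starN. Qed.

Lemma star1 : star (1 : A) = 1.
Proof. by rewrite -[LHS]mulr1 -{2}[1]starK -starM mulr1 starK. Qed.

Lemma starZr r a : star (r%:C *: a) = r%:C *: star a.
Proof. by rewrite starZ conj_Creal // complex_real. Qed.

Lemma star_sum (I : Type) (s : seq I) (P : pred I) (F : I -> A) :
  star (\sum_(i <- s | P i) F i) = \sum_(i <- s | P i) star (F i).
Proof. exact: (big_morph _ starD star0). Qed.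

Lemma nm1 : nm (1 : A) = 1.
Proof.
have n0 : nm (1 : A) != 0 by apply/eqP => /nm_eq0 /eqP; rewrite oner_eq0.
by apply: (mulfI n0); rewrite -expr2 -nm_starM star1 !mulr1.
Qed.

Lemma starM_eq0 a : star a * a = 0 -> a = 0.
Proof.
by move=> a0; apply/nm_eq0/eqP; rewrite -sqrf_eq0 -nm_starM a0 nm0.
Qed.

(* [a + i b] is unitary and [a] is its real part. *)
Lemma nm_le1_sqrD a b : star a = a -> star b = b -> GRing.comm a b ->
  a * a + b * b = 1 -> nm a <= 1.
Proof.
move=> sa sb ab1 sqD.
pose u : A := a + 'i%C *: b.
have su : star u = a - 'i%C *: b.
  by rewrite starD starZ sa sb complexiE conjCi scaleNr.
have uu : star u * u = 1.
  rewrite su mulrDr !mulrBl -!scalerAl -!scalerAr !scalerA -[_ * 'i%C]expr2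
    sqr_i.
  by rewrite scaleN1r ab1 opprK addrA subrK.
have u1 : nm u = 1.
  apply/eqP; rewrite -(@eqrXn2 _ 2) ?nm_ge0 // -nm_starM uu nm1.
  by rewrite expr1n.
have -> : a = (2^-1 : R)%:C *: (u + star u).
  rewrite su /u addrACA subrr addr0 -mulr2n -(@scaler_nat R[i] _ 2 a) scalerA.
  by rewrite -(rmorph_nat (real_complex R)) -rmorphM /= mulVf ?scale1r
    ?pnatr_eq0.
rewrite nmZ ger0_norm; last lra.
by have := nmD u (star u); rewrite nm_star u1; lra.
Qed.

End RealNorm.

(** * The scalar iteration and its rate of convergence *)

Section ScalarIteration.
Context {R : realType}.

(* The iteration [r <- (1 + r ^ 2) / 2] from 0 increases to 1; [gap] is its
   distance to 1. *)
Fixpoint gap n : R := if n is m.+1 then gap m - gap m ^+ 2 / 2 else 1.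

Lemma gapS n : gap n.+1 = gap n - gap n ^+ 2 / 2. Proof. by []. Qed.

Lemma gap_bounds n : 0 < gap n <= 1 /\ gap n * (n%:R + 2) <= 2.
Proof.
elim: n => [|n [/andP[g0 g1] IHn]]; first by rewrite /gap; split; lra.
rewrite gapS -(natr1 n); move: (gap n) (n%:R : R) (ler0n R n) g0 g1 IHn => g m
  m0 g0 g1 gm.
(* Expanded, this product is the bound at [n.+1] up to the nonnegative term [g ^+ 2]. *)
have u0 : 0 <= (2 - g * (m + 2)) * (2 - g) by apply: mulr_ge0; lra.
have gg : g ^+ 2 <= g by rewrite expr2 ler_piMr // ltW.
have g2 := sqr_ge0 g; split; [apply/andP; split| ].
- lra.
- lra.
- lra.
Qed.

(** Since [gap n <= 2 / (n + 2)], a positive [c] fails the bound as soon as [n] exceeds [2 * C / c].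
    Later limit arguments reduce to this. *)
Lemma gap_le0 (c C : R) : 0 <= C -> (forall n, c <= C * gap n) -> c <= 0.
Proof.
move=> C0 cC; rewrite leNgt; apply/negP => c0.
have := archi_boundP (divr_ge0 (mulr_ge0 (ler0n _ 2) C0) (ltW c0)).
set n := Num.bound _; rewrite ltr_pdivrMr // => Cn.
have [/andP[g0 g1] gn] := gap_bounds n; have cn := cC n.
move: (gap n) (n%:R : R) (ler0n R n) g0 g1 gn cn Cn => g m m0 g0 g1 gm cg Cm.
have : c * (m + 2) <= C * 2.
  by apply: le_trans (_ : C * g * (m + 2) <= _); nra.
nra.
Qed.

End ScalarIteration.

(** * Square roots of [1 - z] for self-adjoint [z] in the unit ball *)

Section SquareRoot.
Context {R : realType} {A : cstarAlgType R}.
Implicit Types (z w : A).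

(** A fixed point [r] satisfies [r + r = z + r * r], that is, [(1 - r) ^ 2 = 1 - z]. *)
Fixpoint sqrt_iter z n : A :=
  if n is m.+1 then (2^-1 : R)%:C *: (z + sqrt_iter z m * sqrt_iter z m)
  else 0.

Lemma sqrt_iterS z n : sqrt_iter z n.+1 =
  (2^-1 : R)%:C *: (z + sqrt_iter z n * sqrt_iter z n).
Proof. by []. Qed.

Lemma nm_half z : nm ((2^-1 : R)%:C *: z) = nm z / 2.
Proof. by rewrite nmZ ger0_norm ?invr_ge0 ?ler0n // mulrC. Qed.

Lemma sqrt_iter_nm z n : nm z <= 1 -> nm (sqrt_iter z n) <= 1 - gap n.
Proof.
move=> z1; elim: n => [|n IHn]; first by rewrite nm0 subrr.
rewrite sqrt_iterS nm_half gapS.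
have := nmD z (sqrt_iter z n * sqrt_iter z n).
have := nmM (sqrt_iter z n) (sqrt_iter z n).
have : nm (sqrt_iter z n) * nm (sqrt_iter z n) <= (1 - gap n) * (1 - gap n).
  by apply: ler_pM; rewrite ?nm_ge0.
lra.
Qed.

Lemma subr_sqr_nc (a b : A) : a * a - b * b = a * (a - b) + (a - b) * b.
Proof. by rewrite mulrBr mulrBl addrA subrK. Qed.

(** The increment is half a difference of squares; factoring it bounds each increment by the
    previous one times the mean of two norms, exactly as for the scalar iteration. *)
Lemma sqrt_iter_step z n : nm z <= 1 ->
  nm (sqrt_iter z n.+1 - sqrt_iter z n) <= gap n - gap n.+1.
Proof.
move=> z1; elim: n => [|n IHn].
  by rewrite sqrt_iterS gapS /gap subr0 mulr0 addr0 nm_half; lra.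
rewrite (sqrt_iterS _ n.+1) {2}sqrt_iterS -scalerBr nm_half opprD addrACA subrr
  add0r.
rewrite subr_sqr_nc.
have := sqrt_iter_nm n z1; have := sqrt_iter_nm n.+1 z1.
have [/andP[g0 g1] _] := @gap_bounds R n.
have [/andP[h0 h1] _] := @gap_bounds R n.+1.
move: IHn; set r' := sqrt_iter z n.+1; set r := sqrt_iter z n => IHn nr' nr.
have := nmD (r' * (r' - r)) ((r' - r) * r).
have := nmM r' (r' - r); have := nmM (r' - r) r.
have -> : gap n.+1 - gap n.+2 = (gap n - gap n.+1) * (2 - gap n - gap n.+1) / 2
  :> R.
  by rewrite !gapS; field.
have := nm_ge0 r; have := nm_ge0 r'; have := nm_ge0 (r' - r).
move: (gap n) (gap n.+1) g0 g1 h0 h1 IHn nr nr' => g g' *.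
have : nm r' * nm (r' - r) <= (1 - g') * (g - g') by apply: ler_pM.
have : nm (r' - r) * nm r <= (g - g') * (1 - g) by apply: ler_pM.
lra.
Qed.

Lemma sqrt_iter_dist z m n : nm z <= 1 -> (m <= n)%N ->
  nm (sqrt_iter z n - sqrt_iter z m) <= gap m - gap n.
Proof.
move=> z1 /subnK <-; elim: (n - m)%N => [|k IHk]; first by rewrite !subrr nm0.
rewrite addSn -(subrK (sqrt_iter z (k + m)) (sqrt_iter z _.+1)) -addrA.
apply: (le_trans (nmD _ _)).
have := sqrt_iter_step (k + m) z1; lra.
Qed.

Lemma sqrt_iter_lim z : nm z <= 1 ->
  exists r, forall n, nm (r - sqrt_iter z n) <= gap n.
Proof.
move=> z1.
have cvgr : cvgn (sqrt_iter z).
  apply/cauchy_cvgP/cauchyP => e e0.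
  have e_real : (complex.Re e)%:C = e by rewrite RRe_real // ger0_real // ltW.
  have e'0 : 0 < complex.Re e by rewrite -ltcR e_real.
  have [n gn] : exists n, gap n < complex.Re e.
    apply/not_existsP => gN; have := @gap_le0 R (complex.Re e) 1 ler01.
    rewrite leNgt e'0 => /(_ _)/negP; apply=> //= n; rewrite mul1r leNgt.
    exact/negP/gN.
  exists (sqrt_iter z n); exists n => //= k nk; rewrite -ball_normE /=.
  rewrite nmE -e_real ltcR nmBC; apply: le_lt_trans gn.
  have [/andP[g0 g1] _] := @gap_bounds R k.
  by have := sqrt_iter_dist z1 nk; lra.
exists (limn (sqrt_iter z)) => n.
(* The tolerance is [gap k] for arbitrary [k]; the limit is compared with an iterate of index beyond
   both [N] and [n]. *)
rewrite -subr_le0; apply: (@gap_le0 _ _ 1) => // k.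
have [/andP[k0 _] _] := @gap_bounds R k.
have /cvgrPdist_le/(_ (gap k)%:C) := cvgr.
rewrite ltcR => /(_ k0) [N _ /(_ (maxn N n))] /=.
rewrite leq_maxl nmE lecR => /(_ isT) rk.
rewrite -(subrK (sqrt_iter z (maxn N n)) (limn _)) -addrA mul1r.
have := nmD (limn (sqrt_iter z) - sqrt_iter z (maxn N n)) (sqrt_iter z (maxn N
  n) - sqrt_iter z n).
have := sqrt_iter_dist z1 (leq_maxr N n).
have [/andP[+ _] _] := @gap_bounds R (maxn N n).
lra.
Qed.

Lemma nm_gap_eq0 (C : R) z : 0 <= C -> (forall n, nm z <= C * gap n) -> z = 0.
Proof.
move=> C0 zC; apply/nm_eq0/eqP.
by rewrite eq_le nm_ge0 andbT (gap_le0 C0).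
Qed.

Lemma sqrt_iter_comm z w n : GRing.comm w z -> GRing.comm w (sqrt_iter z n).
Proof.
move=> wz; elim: n => [|n IHn]; first exact: commr0.
by rewrite /GRing.comm sqrt_iterS -scalerAl -scalerAr (commrD wz (commrM IHn
  IHn)).
Qed.

Lemma sqrt_iter_star z n : star z = z -> star (sqrt_iter z n) = sqrt_iter z n.
Proof.
by move=> sz; elim: n => [|n IHn]; rewrite ?star0 // sqrt_iterS starZr starD
  starM IHn sz.
Qed.

(** The root is [1 - r] for the limit [r]. Each identity passes from the iterates to [r] because its
    defect has norm at most a constant times [gap n] for every [n]. *)
Lemma cstar_sqrt z : star z = z -> nm z <= 1 ->
  exists s, [/\ star s = s, s * s = 1 - z, nm (1 - s) <= 1
    & forall w, GRing.comm w z -> GRing.comm w s].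
Proof.
move=> sz z1; have [r rP] := sqrt_iter_lim z1; exists (1 - r).
have sr : star r = r.
  apply/eqP; rewrite -subr_eq0; apply/eqP/(@nm_gap_eq0 2) => // n.
  have -> : star r - r = star (r - sqrt_iter z n) - (r - sqrt_iter z n).
    by rewrite starB sqrt_iter_star // opprB addrA subrK.
  have := nmB (star (r - sqrt_iter z n)) (r - sqrt_iter z n).
  by rewrite nm_star; have := rP n; lra.
have r1 : nm r <= 1 by have := rP 0; rewrite subr0.
split.
- by rewrite starB star1 sr.
- have r2 : r + r = z + r * r.
    apply/eqP; rewrite -subr_eq0; apply/eqP/(@nm_gap_eq0 4) => // n.
    set i := sqrt_iter z.
    have iS : i n.+1 + i n.+1 = z + i n * i n.
      by rewrite -mulr2n -(@scaler_nat R[i] _ 2) /i sqrt_iterS scalerA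
        -(rmorph_nat (real_complex R)) -rmorphM /= mulfV ?scale1r ?pnatr_eq0.
    have -> : r + r - (z + r * r) =
        (r - i n.+1) + (r - i n.+1) - (r * (r - i n) + (r - i n) * i n).
      by rewrite -subr_sqr_nc addrACA -opprD iS !opprD opprK !addrA [RHS]addrAC
        subrK.
    have := nmB (r - i n.+1 + (r - i n.+1)) (r * (r - i n) + (r - i n) * i n).
    have := nmD (r - i n.+1) (r - i n.+1).
    have := nmD (r * (r - i n)) ((r - i n) * i n).
    have := nmM r (r - i n); have := nmM (r - i n) (i n).
    have : nm r * nm (r - i n) <= 1 * gap n by apply: ler_pM; rewrite ?nm_ge0
      ?rP.
    have [/andP[g0 g1] _] := @gap_bounds R n.
    have : nm (r - i n) * nm (i n) <= gap n * 1.
      apply: ler_pM; rewrite ?nm_ge0 ?rP //.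
      by have := sqrt_iter_nm n z1; lra.
    have := rP n.+1; rewrite -/i gapS.
    have : 0 <= (gap n : R) ^+ 2 by apply: sqr_ge0.
    lra.
  rewrite mulrBl mul1r mulrBr mulr1 opprB addrCA -addrA -opprD r2 opprD.
  by rewrite addrC -!addrA addNr addr0.
- by rewrite opprB addrC subrK.
- move=> w wz; apply: commrB; first exact: commr1.
  apply/eqP; rewrite -subr_eq0.
  apply/eqP/(@nm_gap_eq0 (2 * nm w)) => [|n]; first by rewrite mulr_ge0 ?nm_ge0.
  have -> : w * r - r * w = w * (r - sqrt_iter z n) - (r - sqrt_iter z n) * w.
    by rewrite mulrBr mulrBl (sqrt_iter_comm n wz) opprB addrA subrK.
  set d := r - _.
  have := nmB (w * d) (d * w); have := nmM w d; have := nmM d w.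
  have : nm w * nm d <= nm w * gap n by apply: ler_wpM2l; rewrite ?nm_ge0 ?rP.
  lra.
Qed.

End SquareRoot.

(** * The real trace form, absolute values, and unitaries in C*-convex combinations *)

Record faithful_trace (R : realType) (A : cstarAlgType R) (T : A -> R) : Prop :=
  FaithfulTrace {
    trD : {morph T : a b / a + b};
    trC : forall a b, T (a * b) = T (b * a);
    tr_ge0 : forall a, 0 <= T (star a * a);
    tr_eq0 : forall a, T (star a * a) = 0 -> a = 0;
    tr1 : T 1 = 1 }.

(** Positivity makes [tau (star a * a)] real, so faithfulness survives taking the real part. *)
Lemma faithful_trace_Re (R : realType) (A : cstarAlgType R) (tau : {scalar A}) :
  is_tracial_state tau -> is_faithful tau ->
  faithful_trace (fun a => complex.Re (tau a)).
Proof.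
move=> [[tau_ge0 tau1] tauC] tau_eq0; split=> [a b|a b|a|a ta|].
- by rewrite linearD /=; case: (tau a) (tau b) => [? ?] [].
- by rewrite tauC.
- by have := tau_ge0 a; rewrite lecE => /andP[].
- apply: tau_eq0; apply/eqP; rewrite eq_complex ta eqxx.
  by have := tau_ge0 a; rewrite lecE => /andP[].
- by rewrite tau1.
Qed.

Section Trace.
Context {R : realType} {A : cstarAlgType R} {T : A -> R}.
Context (trT : faithful_trace T).
Implicit Types (a b t x y : A).

Lemma tr0 : T 0 = 0.
Proof. by apply: (@addrI _ (T 0)); rewrite -(trD trT) !addr0. Qed.

Lemma trN a : T (- a) = - T a.
Proof. by apply/eqP; rewrite -addr_eq0 -(trD trT) addNr tr0. Qed.

Lemma trB a b : T (a - b) = T a - T b.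
Proof. by rewrite (trD trT) trN. Qed.

Lemma tr_sum (I : Type) (s : seq I) (F : I -> A) :
  T (\sum_(i <- s) F i) = \sum_(i <- s) T (F i).
Proof. exact: (big_morph _ (trD trT) tr0). Qed.

Lemma tr_addr_eq0 a b : star a * a + star b * b = 0 -> a = 0 /\ b = 0.
Proof.
move=> /(congr1 T); rewrite tr0 (trD trT) => /eqP.
by rewrite paddr_eq0 ?(tr_ge0 trT) // => /andP[/eqP + /eqP +]; do 2
  move/(tr_eq0 trT) ->.
Qed.

(* The trace replaces Kaplansky's theorem that [star t * t] is positive: if
   [d] is the difference of [m := |h|] and [h := star t * t], then
   [d h d = - d m d], so that both have trace 0. *)
Lemma cstar_abs_ball t : nm t <= 1 ->
  exists k, [/\ star k = k, k * k = star t * t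
    & forall w, GRing.comm w (star t * t) -> GRing.comm w k].
Proof.
move=> t1; set h := star t * t.
have sh : star h = h by rewrite /h starM starK.
have h1 : nm h <= 1 by rewrite nm_starM expr_le1 ?nm_ge0.
have hh1 : nm (h * h) <= 1.
  by apply: (le_trans (nmM _ _)); rewrite mulr_ile1 ?nm_ge0.
(* Three nested roots: [s ^ 2 = 1 - h ^ 2], then [m ^ 2 = 1 - s ^ 2 = h ^ 2], then
   [k ^ 2 = 1 - (1 - m) = m]. The last one is available because [cstar_sqrt] also bounds
   [nm (1 - m)]. *)
have [||s [ss ssE _ sC]] := @cstar_sqrt _ _ (h * h) => //; first by rewrite
  starM sh.
have hs : GRing.comm h s by apply: sC; exact: commrM.
have s1 : nm s <= 1 by apply: (@nm_le1_sqrD _ _ s h) => //; rewrite ssE subrK.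
have ss1 : nm (s * s) <= 1.
  by apply: (le_trans (nmM _ _)); rewrite mulr_ile1 ?nm_ge0.
have [||m [sm mmE m1 mC]] := @cstar_sqrt _ _ (s * s) => //; first by rewrite
  starM ss.
have hm : GRing.comm h m by apply: mC; exact: commrM.
have mm : m * m = h * h by rewrite mmE ssE opprB addrC subrK.
have [||k [sk kkE _ kC]] := @cstar_sqrt _ _ (1 - m) => //; first by rewrite
  starB star1 sm.
have kk : k * k = m by rewrite kkE opprB addrC subrK.
pose d := m - h.
have dm : GRing.comm d m by apply/commr_sym/commrB => //; exact: commr_sym.
have hd : h * d = - (m * d) by rewrite /d !mulrBr -hm mm opprB.
have sd : star d = d by rewrite starB sm sh.
have [|td kd] := @tr_addr_eq0 (t * d) (k * d).
  rewrite !starM sd sk -mulrA (mulrA (star t)) -/h hd -(mulrA d k) (mulrA k k)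
    kk.
  by rewrite mulrN addNr.
have hd0 : h * d = 0 by rewrite /h -mulrA td mulr0.
have md0 : m * d = 0 by rewrite -kk -mulrA kd mulr0.
have d0 : d = 0 by apply: starM_eq0; rewrite sd {1}/d mulrBl hd0 md0 subrr.
exists k; split=> // [|w wh]; first by rewrite kk; apply/eqP; rewrite -subr_eq0
  -/d d0.
apply: kC; apply: commrB; first exact: commr1.
by apply: mC; apply: commrM; apply: sC; apply: commrM.
Qed.

Lemma cstar_abs t :
  exists k, [/\ star k = k, k * k = star t * t
    & forall w, GRing.comm w (star t * t) -> GRing.comm w k].
Proof.
(* Rescaling into the ball; the added 1 keeps [c] positive when [t = 0]. *)
pose c : R := nm t + 1; have c0 : 0 < c by have := nm_ge0 t; rewrite /c; lra.
have cK (a : A) : c%:C *: (c^-1%:C *: a) = a.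
  by rewrite scalerA -rmorphM /= divff ?scale1r // gt_eqF.
have [|k [sk kk kC]] := @cstar_abs_ball (c^-1%:C *: t).
  by rewrite nmZ gtr0_norm ?invr_gt0 // mulrC ler_pdivrMr // mul1r /c; lra.
have tE : star (c^-1%:C *: t) * (c^-1%:C *: t) = c^-1%:C *: (c^-1%:C *: (star t
  * t)).
  by rewrite starZr -scalerAl -scalerAr.
exists (c%:C *: k); split; first by rewrite starZr sk.
  by rewrite -scalerAl -scalerAr kk tE !cK.
move=> w wt; rewrite /GRing.comm -scalerAl -scalerAr kC //.
by rewrite tE /GRing.comm -!scalerAr -!scalerAl wt.
Qed.

(** With [s ^ 2 = 1 - star y * y], the difference of the two sides is
    [T (star (s * a) * (s * a))]. *)
Lemma tr_ball a y : cstar_ball y -> T (star (y * a) * (y * a)) <= T (star a *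
  a).
Proof.
rewrite cstar_ballE => y1.
have [||s [ss ssE _ _]] := @cstar_sqrt _ _ (star y * y).
- by rewrite starM starK.
- by rewrite nm_starM expr_le1 ?nm_ge0.
have := tr_ge0 trT (s * a).
rewrite !starM ss -!mulrA (mulrA s) ssE mulrBl mul1r mulrBr trB subr_ge0.
by rewrite !mulrA.
Qed.

(* Equality case of Cauchy-Schwarz for [(a, b) |-> T (star a * b)]: the
   nonnegative numbers [T (star d_i * d_i)], [d_i := y_i t_i - t_i x], sum
   up to at most [1 + 1 - 1 - 1]. *)
Lemma unitary_intertwine x k (y t : 'I_k -> A) : cstar_unitary x ->
    (forall i, cstar_ball (y i)) -> \sum_(i < k) star (t i) * t i = 1 ->
    x = \sum_(i < k) star (t i) * y i * t i ->
  forall i, y i * t i = t i * x.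
Proof.
move=> [xx xx'] y1 tt xE i.
pose d i := y i * t i - t i * x.
have dE j : star (d j) * d j = star (y j * t j) * (y j * t j)
    - star (star (t j) * y j * t j) * x - star x * (star (t j) * y j * t j)
    + star x * (star (t j) * t j) * x.
  rewrite /d starB mulrBr !mulrBl !starM starK !mulrA opprB addrA addrAC.
  by congr (_ + _); rewrite addrAC.
have trd : \sum_i T (star (d i) * d i) <= 0.
  have tdE j : T (star (d j) * d j) <= T (star (t j) * t j) + T (star (t j) * t
    j)
      - (T (star (star (t j) * y j * t j) * x) + T (star x * (star (t j) * y j
          * t j))).
    rewrite dE (trD trT) !trB -(mulrA (star x)) (trC trT (star x) (_ * x)) -[_
      * x * star x]mulrA xx' mulr1.
    by have := tr_ball (t j) (y1 j); lra.
  apply: le_trans (ler_sum _ (fun j _ => tdE j)) _.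
  rewrite sumrB !big_split /= -!tr_sum -mulr_suml -mulr_sumr -star_sum -xE tt
    xx.
  by rewrite subrr.
have d0 : T (star (d i) * d i) = 0.
  apply/eqP; rewrite eq_le (tr_ge0 trT) andbT; apply: le_trans trd.
  by rewrite (bigD1 i) //= lerDl sumr_ge0 // => j _; exact: (tr_ge0 trT).
by apply/eqP; rewrite -subr_eq0; apply/eqP/(tr_eq0 trT).
Qed.

Lemma unitary_similar x y t : cstar_unitary x -> cstar_ball y ->
    cstar_invertible t -> y * t = t * x ->
  exists u, cstar_unitary u /\ y = star u * x * u.
Proof.
move=> [xx xx'] y1 [r [rt tr]] yt.
(* With [s ^ 2 = 1 - star y * y], the relation [y * t = t * x] and unitarity of [x] make
   [T (star (s * t) * (s * t))] vanish, and [t] cancels. *)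
have yy : star y * y = 1.
  have [||s [ss ssE _ _]] := @cstar_sqrt _ _ (star y * y).
  - by rewrite starM starK.
  - by rewrite nm_starM expr_le1 ?nm_ge0 // -cstar_ballE.
  have st0 : s * t = 0.
    apply: (tr_eq0 trT).
    rewrite starM ss -mulrA (mulrA s) ssE mulrBl mul1r mulrBr -(mulrA (star y))
      yt.
    rewrite (mulrA (star t)) -starM yt starM trB (trC trT (star x * _)) mulrA.
    by rewrite -[t * x * _]mulrA xx' mulr1 (trC trT t) subrr.
  have s0 : s = 0 by rewrite -[s]mulr1 -tr mulrA st0 mul0r.
  by apply/eqP; rewrite eq_sym -subr_eq0 -ssE s0 mulr0.
have [k [sk kk kC]] := cstar_abs t.
have xk : GRing.comm x k.
  apply: kC.
  have xh : star x * (star t * t) * x = star t * t.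
    by rewrite !mulrA -starM -mulrA -yt starM -mulrA (mulrA (star y)) yy mul1r.
  by rewrite /GRing.comm -{1}xh !mulrA xx' mul1r.
(* [g] is the inverse of [k * k = star t * t], hence [j := k * g] below is the inverse of [k]. *)
have [g [sg kkg gkk gt]] : exists g,
    [/\ star g = g, k * k * g = 1, g * (k * k) = 1 & g * star t = r].
  exists (r * star r); rewrite kk; split.
  - by rewrite starM starK.
  - by rewrite -mulrA (mulrA t) tr mul1r -starM rt star1.
  - by rewrite -mulrA (mulrA (star r)) -starM tr star1 mul1r rt.
  - by rewrite -mulrA -starM tr star1 mulr1.
have [j [sj kj jk jj]] :
    exists j, [/\ star j = j, k * j = 1, j * k = 1 & j * j = g].
  have gk : g * k = k * g.
    by rewrite -[LHS]mulr1 -kkg !mulrA -(mulrA g k) gkk mul1r.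
  exists (k * g); split; first by rewrite starM sk sg gk.
  - by rewrite mulrA.
  - by rewrite -gk -mulrA.
  - by rewrite -{1}gk -mulrA (mulrA k) kkg mulr1.
have xj : x * j = j * x.
  by rewrite -[LHS]mul1r -jk -!mulrA (mulrA k) -xk -mulrA kj mulr1.
(* The adjoint of the unitary part [t * j] of [t], since the goal reads [star u * x * u]. *)
exists (star (t * j)); rewrite /cstar_unitary starK; split; first split.
- by rewrite starM sj mulrA -(mulrA t) jj -mulrA gt tr.
- by rewrite starM sj -mulrA (mulrA (star t)) -kk -mulrA kj mulr1 jk.
rewrite starM sj -[t * j * x]mulrA -xj !mulrA -[_ * j * j]mulrA jj -[_ * g *
  _]mulrA gt.
by rewrite -yt -mulrA tr mulr1.
Qed.
End Trace.

(** * Points with no symmetric perturbation inside the ball are unitary *)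

Section Rigid.
Context {R : realType} {A : cstarAlgType R} {T : A -> R}.
Context (trT : faithful_trace T).
Implicit Types (a b t x y z : A).

(** The midpoint form of linear extremality, through which both notions of extreme point lead to
    unitarity. *)
Definition rigid x := forall b, nm (x + b) <= 1 -> nm (x - b) <= 1 -> b = 0.

Lemma commr_scale (c : R[i]) a b : GRing.comm a b -> GRing.comm a (c *: b).
Proof. by move=> ab; rewrite /GRing.comm -scalerAr -scalerAl ab. Qed.

(* With [z := 1 - star x * x] and [g := 1 + e z], the norm of [x g] is that of
   [|x| g], and [1 - (|x| g) ^ 2 = z (g ^ 2 - 2 e - e ^ 2 z)] is a square. *)
Lemma nm_mul_perturb x (e : R) : nm x <= 1 -> `|e| <= 8^-1 ->
  nm (x * (1 + e%:C *: (1 - star x * x))) <= 1.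
Proof.
move=> x1 e8; set h := star x * x; set z := 1 - h.
have sh : star h = h by rewrite starM starK.
have sz : star z = z by rewrite starB star1 sh.
have h1 : nm h <= 1 by rewrite nm_starM expr_le1 ?nm_ge0.
have z2 : nm z <= 2 by have := nmB 1 h; rewrite nm1 -/z; lra.
have [k [sk kk kC]] := cstar_abs trT x.
have [s [ss ssE _ sC]] := cstar_sqrt sh h1.
pose f := e%:C *: z; pose g := 1 + f.
pose v := (e + e)%:C *: (1 : A) + (e * e)%:C *: z.
have zv : z * v = f + f + f * f.
  rewrite mulrDr -!scalerAr mulr1 rmorphD scalerDl; congr (_ + _).
  by rewrite /f -scalerAl scalerA rmorphM.
have gg : g * g = 1 + (f + f + f * f).
  by rewrite mulrDl mul1r mulrDr mulr1 -!addrA.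
(* As [z * v = g * g - 1], the square to be found is [z * (g * g - v) = (1 - h) * (1 - w)]. The
   bound 1/8 on [e] keeps [w] in the ball, so [1 - w] has a root too. *)
pose w := v - (f + f + f * f).
have wE : 1 - w = g * g - v by rewrite gg opprB addrA.
have sf : star f = f by rewrite starZr sz.
have sg : star g = g by rewrite starD star1 sf.
have sw : star w = w by rewrite starB !starD !starZr star1 sz starM sf.
have f4 : nm f <= 4^-1.
  rewrite nmZ; have : `|e| * nm z <= 8^-1 * 2 by apply: ler_pM; rewrite ?nm_ge0.
  lra.
have w1 : nm w <= 1.
  have ff : nm (f * f) <= 16^-1.
    have := nmM f f; have : nm f * nm f <= 4^-1 * 4^-1.
      by apply: ler_pM; rewrite ?nm_ge0.
    lra.
  have e2 : nm ((e + e)%:C *: (1 : A)) <= 4^-1.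
    by rewrite nmZ nm1 mulr1; have := ler_normD e e; lra.
  have ez : nm ((e * e)%:C *: z) <= 32^-1.
    rewrite nmZ normrM.
    have : `|e| * `|e| <= 8^-1 * 8^-1 by apply: ler_pM.
    have := nm_ge0 z; have := normr_ge0 e; nra.
  have := nmB v (f + f + f * f); have := nmD (f + f) (f * f); have := nmD f f.
  have := nmD ((e + e)%:C *: (1 : A)) ((e * e)%:C *: z).
  rewrite -/v -/w; lra.
have [r [sr rrE _ rC]] := cstar_sqrt sw w1.
have zC a : GRing.comm a h -> GRing.comm a z.
  by move=> ah; apply: commrB => //; exact: commr1.
have gC a : GRing.comm a h -> GRing.comm a g.
  by move=> ah; apply: commrD; [exact: commr1 | apply/commr_scale/zC].
have wC a : GRing.comm a h -> GRing.comm a w.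
  move=> ah; have af : GRing.comm a f by apply/commr_scale/zC.
  apply: commrB; last by apply: commrD; [apply: commrD | apply: commrM].
  by apply: commrD; apply: commr_scale; [exact: commr1 | exact: zC].
have kh : GRing.comm k h by rewrite /h -kk; exact: commrM.
have gh : GRing.comm g h by apply/commr_sym/gC.
have sh' : GRing.comm s h by apply/commr_sym/sC.
have rh : GRing.comm r h by apply/commr_sym/rC/wC.
have kg : k * g = g * k by exact: gC.
have rs : r * s = s * r by exact: sC.
have skg : star (k * g) = k * g by rewrite starM sk sg.
have kgE : k * g * (k * g) = h * (g * g).
  by rewrite -mulrA (mulrA g) -kg -(mulrA k) mulrA kk.
have a1 : nm (k * g) <= 1.
  apply: (@nm_le1_sqrD _ _ _ (s * r)).
  - by [].
  - by rewrite starM ss sr.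
  - have comm_sr a : GRing.comm a h -> GRing.comm a (s * r).
      by move=> ah; apply: commrM; [exact: sC | exact/rC/wC].
    by apply/comm_sr/commr_sym/commrM; apply: commr_sym.
  - have -> : s * r * (s * r) = z * (g * g) - (f + f + f * f).
      by rewrite -mulrA (mulrA r) rs -!mulrA mulrA ssE rrE wE mulrBr zv.
    by rewrite kgE addrA -mulrDl (_ : h + z = 1) ?mul1r ?gg ?addrK // addrC
      subrK.
have : nm (x * g) ^+ 2 <= 1.
  rewrite -nm_starM starM sg -mulrA (mulrA (star x)) -/h.
  by rewrite mulrA gh -mulrA -kgE -{1}skg nm_starM expr_le1 ?nm_ge0.
by rewrite expr_le1 ?nm_ge0.
Qed.

(** The perturbation above is allowed for [e] equal to 1/8 and to -1/8, so rigidity kills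
    [x * (1 - star x * x)]. *)
Lemma rigid_partial_isometry x : nm x <= 1 -> rigid x -> x * (star x * x) = x.
Proof.
move=> x1 rx; have nb (e : R) : `|e| <= 8^-1 ->
    nm (x + e%:C *: (x * (1 - star x * x))) <= 1.
  by move=> e8; have := nm_mul_perturb x1 e8; rewrite mulrDr mulr1 -scalerAr.
have e8 : `|8^-1 : R| <= 8^-1 by rewrite ger0_norm ?invr_ge0 ?ler0n.
have /eqP : (8^-1 : R)%:C *: (x * (1 - star x * x)) = 0.
  apply: rx; first exact: nb.
  by rewrite -scaleNr -rmorphN nb // normrN.
rewrite scaler_eq0 (fmorph_eq0 (real_complex R)) invr_eq0 pnatr_eq0 /=.
by rewrite mulrBr mulr1 subr_eq0 => /eqP <-.
Qed.

(** Initial and final spaces are orthogonal, so [star (x + b) * (x + b) = e + m] with [e] a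
    projection and [e * m = 0]. If [s ^ 2 = 1 - m ^ 2], then
    [(e + m) ^ 2 + ((1 - e) * s) ^ 2 = 1]. *)
Lemma nm_partial_isometryD x b : x * (star x * x) = x -> star x * b = 0 ->
  b * star x = 0 -> nm b <= 1 -> nm (x + b) <= 1.
Proof.
move=> xxx xb bx b1.
pose e := star x * x; pose m := star b * b.
have se : star e = e by rewrite starM starK.
have sm : star m = m by rewrite starM starK.
have ee : e * e = e by rewrite /e -mulrA xxx.
have xb' : x * star b = 0 by rewrite -[x]starK -starM bx star0.
have em : e * m = 0 by rewrite /e /m mulrA -(mulrA (star x)) xb' mulr0 mul0r.
have me : m * e = 0 by rewrite -sm -se -starM em star0.
have sqE : star (x + b) * (x + b) = e + m.
  have bx' : star b * x = 0 by rewrite -[x]starK -starM xb star0.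
  by rewrite starD mulrDl !mulrDr xb bx' addr0 add0r.
have m1 : nm (m * m) <= 1.
  have m1 : nm m <= 1 by rewrite nm_starM expr_le1 ?nm_ge0.
  by apply: (le_trans (nmM _ _)); rewrite mulr_ile1 ?nm_ge0.
have [|s [ss ssE _ sC]] := cstar_sqrt _ m1; first by rewrite starM sm.
have es : e * s = s * e by apply: sC; rewrite /GRing.comm mulrA em mul0r -mulrA
  me mulr0.
have ms : GRing.comm m s by apply/sC/commrM.
have pa : GRing.comm (e + m) (1 - e).
  apply: commrB; first exact: commr1.
  by rewrite /GRing.comm mulrDl mulrDr me em.
have : nm (x + b) ^+ 2 <= 1.
  rewrite -nm_starM sqE; apply: (@nm_le1_sqrD _ _ _ ((1 - e) * s)).
  - by rewrite starD se sm.
  - by rewrite starM ss starB star1 se mulrBl mulrBr mulr1 mul1r es.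
  - apply: commrM => //; apply/commr_sym/commrD; apply: commr_sym => //; exact:
      es.
  - have -> : (e + m) * (e + m) = e + m * m.
      by rewrite mulrDl !mulrDr ee em me addr0 add0r.
    have -> : (1 - e) * s * ((1 - e) * s) = 1 - e - m * m.
      have pp : (1 - e) * (1 - e) = 1 - e.
        by rewrite mulrBr mulr1 mulrBl mul1r ee subrr subr0.
      have sp : s * (1 - e) = (1 - e) * s by rewrite mulrBl mulrBr mulr1 mul1r
        es.
      rewrite -(mulrA _ s) (mulrA s) sp -(mulrA _ s s) ssE mulrA pp.
      by rewrite mulrBr mulr1 mulrBl mul1r (mulrA e) em mul0r subr0.
    by rewrite -[1 - e - _]addrA -opprD [LHS]addrC subrK.
by rewrite expr_le1 ?nm_ge0.
Qed.

Lemma rigid_orthogonal x b : nm x <= 1 -> rigid x ->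
  star x * b = 0 -> b * star x = 0 -> b = 0.
Proof.
move=> x1 rx xb bx; have xxx := rigid_partial_isometry x1 rx.
pose c : R := nm b + 1; have c0 : 0 < c by have := nm_ge0 b; rewrite /c; lra.
have c1 : nm (c^-1%:C *: b) <= 1.
  by rewrite nmZ gtr0_norm ?invr_gt0 // mulrC ler_pdivrMr // mul1r /c; lra.
have xcb : star x * (c^-1%:C *: b) = 0 by rewrite -scalerAr xb scaler0.
have cbx : c^-1%:C *: b * star x = 0 by rewrite -scalerAl bx scaler0.
have /eqP : c^-1%:C *: b = 0.
  apply: rx; apply: nm_partial_isometryD; rewrite ?nmN //.
    by rewrite mulrN xcb oppr0.
  by rewrite mulNr cbx oppr0.
rewrite scaler_eq0 (fmorph_eq0 (real_complex R)) invr_eq0 (gt_eqF c0) /=.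
by move/eqP.
Qed.

Lemma starX x n : star (x ^+ n) = star x ^+ n.
Proof.
elim: n => [|n IHn]; first by rewrite !expr0 star1.
by rewrite exprSr starM IHn -exprS.
Qed.

Lemma rigid_unitary x : nm x <= 1 -> rigid x -> cstar_unitary x.
Proof.
move=> x1 rx; have xxx := rigid_partial_isometry x1 rx.
have xxx' : star x * x * star x = star x by rewrite -[in RHS]xxx !starM starK.
pose p := 1 - star x * x; pose q := 1 - x * star x.
have xq : star x * q = 0 by rewrite mulrBr mulr1 mulrA xxx' subrr.
have px : p * star x = 0 by rewrite mulrBl mul1r xxx' subrr.
have pp : star p * p = p.
  by rewrite starB star1 starM starK mulrBr mulr1 mulrA px mul0r subr0.
have qq : star q * q = q.
  by rewrite starB star1 starM starK mulrBl mul1r -mulrA xq mulr0 subr0.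
have qap a : q * a * p = 0.
  apply: (rigid_orthogonal x1 rx); last by rewrite -(mulrA _ p) px mulr0.
  by rewrite -(mulrA q) (mulrA (star x)) xq mul0r.
(* By [qap], [star x ^+ n * p] is fixed by [x * star x], so each factor [x] undoes one [star x]. *)
have xnp n : x ^+ n * (star x ^+ n * p) = p.
  elim: n => [|n IHn]; first by rewrite !mul1r.
  rewrite exprSr -mulrA -{2}IHn; congr (_ * _).
  have := qap (star x ^+ n); rewrite -mulrA [q * _]mulrBl mul1r.
  move/eqP; rewrite subr_eq0 => /eqP yE.
  by rewrite exprS -(mulrA (star x)) (mulrA x) -yE.
(* Passing to [n.+1] removes [T (star x ^+ n * p * x ^+ n)], which is [T p] by cyclicity and
   [xnp]. *)
have trx n : T (star (x ^+ n) * x ^+ n) = 1 - n%:R * T p.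
  elim: n => [|n IHn]; first by rewrite expr0 star1 mul1r (tr1 trT) mul0r subr0.
  rewrite -natr1 mulrDl mul1r opprD addrA -IHn.
  rewrite -[in T p](xnp n) (trC trT (x ^+ n)) -(trB trT).
  rewrite !starX (exprSr (star x)) (exprS x) -!mulrA -mulrBr; congr (T (_ * _)).
  by rewrite /p mulrBl mul1r mulrA opprB addrC subrK.
have p0 : p = 0.
  apply: (tr_eq0 trT); rewrite pp; apply/eqP; rewrite eq_le -{2}pp (tr_ge0 trT)
    andbT.
  rewrite leNgt; apply/negP => Tp.
  have := archi_boundP (ltW (divr_gt0 ltr01 Tp)); set n := Num.bound _.
  rewrite ltr_pdivrMr // => n1.
  by have := tr_ge0 trT (x ^+ n); rewrite trx; lra.
have xx : star x * x = 1 by apply/eqP; rewrite eq_sym -subr_eq0 -/p p0.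
have q0 : q = 0.
  by apply: (tr_eq0 trT); rewrite qq /q (trB trT) (trC trT) xx subrr.
by split=> //; apply/eqP; rewrite eq_sym -subr_eq0 -/q q0.
Qed.

End Rigid.

(** * Both notions of extremality compared with rigidity and unitarity *)

Section Extremality.
Context {R : realType} {A : cstarAlgType R} {T : A -> R}.
Context (trT : faithful_trace T).
Implicit Types (x y z u : A) (r : R).

Lemma half_sum x b :
  (2^-1 : R)%:C *: (x + b) + (2^-1 : R)%:C *: (x - b) = x.
Proof.
rewrite -scalerDr addrACA subrr addr0 -mulr2n -(@scaler_nat R[i] _ 2) scalerA.
by rewrite -(rmorph_nat (real_complex R)) -rmorphM /= mulVf ?scale1r ?pnatr_eq0.
Qed.

Lemma linear_extreme_rigid x : linear_extreme_point cstar_ball x -> rigid x.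
Proof.
move=> [_ ext] b b1 b2; have [||||xb _] := ext (x + b) (x - b) (2^-1 : R).
- by rewrite cstar_ballE.
- by rewrite cstar_ballE.
- by apply/andP; split; lra.
- by rewrite (_ : 1 - 2^-1 = 2^-1 :> R) ?half_sum //; field.
by apply: (@addrI _ x); rewrite xb addr0.
Qed.

Lemma tr_similar x u : cstar_unitary u ->
  T (star (star u * x * u) * (star u * x * u)) = T (star x * x).
Proof.
move=> [_ uu]; rewrite !starM starK (trC trT) -!mulrA (mulrA u (star u)) uu
  mul1r.
by rewrite (trC trT) -!mulrA uu mulr1 (trC trT).
Qed.

Lemma tr_parallelogram x b :
  T (star (x + b) * (x + b)) + T (star (x - b) * (x - b)) =
  T (star x * x) + T (star x * x) + (T (star b * b) + T (star b * b)).
Proof.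
rewrite starD starB !mulrBr !mulrBl !mulrDr !mulrDl.
by rewrite !(trB trT) !(trD trT); lra.
Qed.

(** Scalar coefficients [Num.sqrt r] turn an ordinary convex combination into a C*-convex one. *)
Lemma scalar_weight r y : 0 <= r ->
  star ((Num.sqrt r)%:C *: (1 : A)) * y * ((Num.sqrt r)%:C *: 1) = r%:C *: y.
Proof.
move=> r0; rewrite starZr star1 -!scalerAl mul1r -scalerAr mulr1 scalerA.
by rewrite -rmorphM /= -expr2 sqr_sqrtr.
Qed.

Lemma cstar_extreme_rigid x : cstar_extreme_point x -> rigid x.
Proof.
move=> [_ ext] b b1 b2.
pose y (i : 'I_2) := if i == ord0 then x + b else x - b.
pose t (i : 'I_2) := (Num.sqrt (2^-1 : R))%:C *: (1 : A).
have half0 : 0 <= 2^-1 :> R by rewrite invr_ge0 ler0n.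
have [||||u uP] := ext 2 y t.
- by move=> i; rewrite cstar_ballE /y; case: ifP.
- move=> i; exists ((Num.sqrt (2^-1 : R))^-1%:C *: 1).
  rewrite -!scalerAl -!scalerAr !mulr1 !scalerA -!rmorphM /= mulVf ?mulfV
    ?scale1r //;
    by rewrite gt_eqF // sqrtr_gt0 invr_gt0 ltr0n.
- rewrite big_ord_recl big_ord1.
  have := scalar_weight 1 half0; rewrite mulr1 /t => ->.
  by have := half_sum 1 0; rewrite subr0 addr0.
- by rewrite big_ord_recl big_ord1 /t !scalar_weight // /y /= half_sum.
(* Unitary equivalence gives [x + b], [x - b] and [x] the same value of [T (star a * a)], so the
   identity leaves [T (star b * b) = 0]. *)
have := tr_parallelogram x b.
have [uu0 E0] := uP ord0; have [uu1 E1] := uP (lift ord0 ord0).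
rewrite -[x + b]/(y ord0) -[x - b]/(y (lift ord0 ord0)) E0 E1 !tr_similar //.
move=> E; apply: (tr_eq0 trT); lra.
Qed.

Lemma unitary_ball u : cstar_unitary u -> cstar_ball u.
Proof.
move=> [uu _]; rewrite cstar_ballE -(@expr_le1 _ 2) ?nm_ge0 //.
by rewrite -nm_starM uu nm1.
Qed.

Lemma unitary_cstar_extreme x : cstar_unitary x -> cstar_extreme_point x.
Proof.
move=> ux; split=> [|k y t y1 tV tt xE]; first exact: unitary_ball.
have yt := unitary_intertwine trT ux y1 tt xE.
have /choice[u uP] : forall i, exists u, cstar_unitary u /\ y i = star u * x *
  u.
  by move=> i; exact: (unitary_similar trT ux (y1 i) (tV i) (yt i)).
by exists u.
Qed.

Lemma unitary_linear_extreme x : cstar_unitary x -> linear_extreme_point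
  cstar_ball x.
Proof.
move=> ux; split=> [|y z s y1 z1 /andP[s0 s1] xE]; first exact: unitary_ball.
have s1' : 0 < 1 - s by rewrite subr_gt0.
pose v (i : 'I_2) := if i == ord0 then y else z.
pose r (i : 'I_2) := if i == ord0 then s else 1 - s.
pose t (i : 'I_2) := (Num.sqrt (r i))%:C *: (1 : A).
have r0 i : 0 < r i by rewrite /r; case: ifP.
(* For scalar [t i] the intertwining relation [v i * t i = t i * x] cancels to [v i = x]. *)
have vt := @unitary_intertwine _ _ _ trT x 2 v t ux.
have vE i : v i = x.
  have : v i * t i = t i * x.
    apply: vt => [j||].
    - by rewrite /v; case: ifP.
    - rewrite big_ord_recl big_ord1.
      have w j := scalar_weight 1 (ltW (r0 j)).
      rewrite -[star (t ord0)]mulr1 -[star (t (lift _ _))]mulr1 !w -scalerDl.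
      by rewrite -rmorphD /r /= addrC subrK scale1r.
    - by rewrite big_ord_recl big_ord1 !scalar_weight ?ltW.
  rewrite /t -scalerAr -scalerAl mulr1 mul1r => /scalerI; apply.
  by rewrite (fmorph_eq0 (real_complex R)) gt_eqF // sqrtr_gt0.
by split; [exact: (vE ord0) | exact: (vE (lift ord0 ord0))].
Qed.

End Extremality.

Theorem theorem2p3 (R : realType) (A : cstarAlgType R)
    (htau : exists tau : {scalar A}, is_tracial_state tau /\ is_faithful tau)
    (x : A) (hx : cstar_ball x) :
  (cstar_unitary x <-> cstar_extreme_point x) /\
  (cstar_extreme_point x <-> linear_extreme_point cstar_ball x).
Proof.
have [tau [tau_tr tau_faithful]] := htau.
have trT := faithful_trace_Re tau_tr tau_faithful.
have x1 : nm x <= 1 by rewrite -cstar_ballE.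
split; split.
- exact: (unitary_cstar_extreme trT).
- by move=> /(cstar_extreme_rigid trT)/(rigid_unitary trT x1).
- by move=> /(cstar_extreme_rigid trT)/(rigid_unitary trT
    x1)/(unitary_linear_extreme trT).
- by move=> /linear_extreme_rigid/(rigid_unitary trT x1)/(unitary_cstar_extreme
    trT).
Qed.
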